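(* Let $d=(d_1,\ldots,d_n)$ be a vector with positive entries and let $D$ be the $n\times n$ diagonal matrix with diagonal entries $d_1,\ldots,d_n$. Let $$\mathcal{O}_d=\left\{M\begin{bmatrix}D&0\\0&D\end{bmatrix}M^T : M\in Sp(2n)\right\}$$ be the symplectic orbit of $\begin{bmatrix}D&0\\0&D\end{bmatrix}$ (i.e. the set of all $2n\times 2n$ real positive definite matrices whose symplectic eigenvalues, counted with multiplicity, are $d_1,\ldots,d_n$). Then the image of the map $\Delta_s:\mathcal{O}_d\to\mathbb{R}^n$ is exactly the set $\Sigma_d$.
   Context: Let $J=\begin{bmatrix}0 & I_n\\ -I_n & 0\end{bmatrix}$ and $Sp(2n)=\{M\in\mathbb{R}^{2n\times 2n}: M^TJM=J\}$. The symplectic eigenvalues of a $2n\times 2n$ real positive definite matrix $A$ are the diagonal entries of the positive diagonal matrix $D'$ such that $M^TAM=\begin{bmatrix}D'&0\\0&D'\end{bmatrix}$ for some $M\in Sp(2n)$ (Williamson's theorem; they are uniquely determined by $A$). For a $2n\times 2n$ real positive definite matrix $A=(a_{ij})$, define $\Delta_s(A)\in\mathbb{R}^n$ by $\Delta_s(A)_j=(a_{jj}\,a_{n+j,n+j})^{1/2}$, $1\le j\le n$. For $x,y\in\mathbb{R}^n$, $x$ is majorised by $y$, written $x\prec y$, if $\sum_{j=1}^k x_j^{\downarrow}\le\sum_{j=1}^k y_j^{\downarrow}$ for $1\le k\le n$ with equality for $k=n$, where $x_1^\downarrow\ge\cdots\ge x_n^\downarrow$ is the decreasing rearrangement. For $z,x\in\mathbb{R}^n$,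 $z\le x$ means $z_j\le x_j$ for all $j$. Define $$\Sigma_d=\bigcup_{z\prec d}\{x\in\mathbb{R}^n: z\le x\},$$ equivalently the set of $x$ with $\sum_{j=1}^k x_j^{\uparrow}\ge\sum_{j=1}^k d_j^{\uparrow}$ for $1\le k\le n$ (increasing rearrangements); it is the union of translates of the positive orthant $\mathbb{R}^n_+$ attached at each point of the convex hull of the coordinate permutations of $d$. *)

(* Defs.v *)
From HB Require Import structures.
From mathcomp Require Import all_boot all_order all_algebra.
From mathcomp Require Import reals.
Set Implicit Arguments. Unset Strict Implicit. Unset Printing Implicit Defensive.
Import Order.TTheory GRing.Theory Num.Theory.
Local Open Scope ring_scope.

Section Defs.
Variable R : realType.

Definition Jmat (n : nat) : 'M[R]_(n + n) :=
  block_mx 0 1%:M (- 1%:M) 0.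

Definition symplectic (n : nat) (M : 'M[R]_(n + n)) : Prop :=
  M^T *m Jmat n *m M = Jmat n.

Definition dblock (n : nat) (d : 'rV[R]_n) : 'M[R]_(n + n) :=
  block_mx (diag_mx d) 0 0 (diag_mx d).

Definition in_sym_orbit (n : nat) (d : 'rV[R]_n) (A : 'M[R]_(n + n)) : Prop :=
  exists2 M : 'M[R]_(n + n), symplectic M & A = M *m dblock d *m M^T.

Definition Delta_s (n : nat) (A : 'M[R]_(n + n)) : 'rV[R]_n :=
  \row_j Num.sqrt (A (lshift n j) (lshift n j) * A (rshift n j) (rshift n j)).

Definition decr (n : nat) (x : 'rV[R]_n) : seq R :=
  sort (fun a b => b <= a) [seq x 0 i | i <- enum 'I_n].

Definition majorized (n : nat) (x y : 'rV[R]_n) : Prop :=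
  (forall k : nat, (k <= n)%N ->
     \sum_(i < k) (decr x)`_i <= \sum_(i < k) (decr y)`_i) /\
  \sum_(i < n) (decr x)`_i = \sum_(i < n) (decr y)`_i.

Definition Sigma (n : nat) (d x : 'rV[R]_n) : Prop :=
  exists z : 'rV[R]_n, majorized z d /\ forall i, z 0 i <= x 0 i.

End Defs.

(* Main.v *)
Require Import Defs.
From HB Require Import structures.
From mathcomp Require Import all_boot all_order all_algebra.
From mathcomp Require Import fingroup perm.
From mathcomp Require Import reals.
From mathcomp Require Import ring lra zify.
Import Order.TTheory GRing.Theory Num.Theory.
Local Open Scope ring_scope.

(* Necessity: after a diagonal symplectic scaling of [M] the entries of
   [Delta_s A] over a set [I] add up to [\sum_k d_k w_k], where [2 w_k] is the
   sum of squares of the entries of [M] lying in the row pairs indexed by [I]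
   and the column pair [k]. A rank and trace argument on the form [J] gives
   [w(K) >= |I| + |K| - n] for every set [K], hence by summation by parts the
   total is at least the sum of the [|I|] smallest entries of [d]. These
   inequalities, whose right-hand sides are supermodular in [I], allow [x] to be
   lowered to a vector majorised by [d].

   Sufficiency: if [z] is majorised by [d], plane rotations give an orthogonal
   [O] such that [O D O^T] has diagonal [z] (Horn). Then
   [M = block_mx O 0 (S O) O] with [S] diagonal is symplectic, and the diagonal
   blocks of the resulting matrix are [B = O D O^T] and [S B S + B], so that
   [Delta_s] has entries [z_j sqrt(1 + s_j^2)], which take any values
   [x_j >= z_j]. *)

(** * Quadratic bounds for symplectic matrices *)

Lemma mxtrace_gram_ge0 (R : realFieldType) m p (A : 'M[R]_(m, p)) :
  0 <= \tr (A *m A^T).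
Proof.
rewrite /mxtrace sumr_ge0 // => i _; rewrite mxE sumr_ge0 // => j _.
by rewrite !mxE -expr2 sqr_ge0.
Qed.

(** If [v B B^T = 0], the entries of [v B] have zero sum of squares, so [v B = 0] over an ordered
    field. *)
Lemma gram_unitmx (R : realFieldType) m p (B : 'M[R]_(m, p)) :
  row_free B -> B *m B^T \in unitmx.
Proof.
move=> fB; rewrite -row_free_unit; apply/inj_row_free => v vBB.
have vBvB : (v *m B) *m (v *m B)^T = 0.
  by rewrite trmx_mul mulmxA -(mulmxA v) vBB mul0mx.
have vB0 : v *m B = 0.
  apply/rowP => j; rewrite [RHS]mxE; apply/eqP; rewrite -sqrf_eq0.
  move/matrixP/(_ 0 0): vBvB; rewrite mxE [RHS]mxE => /eqP.
  rewrite psumr_eq0; last by move=> k _; rewrite [_^T _ _]mxE -expr2 sqr_ge0.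
  by move/allP/(_ j (mem_index_enum _)); rewrite /= [_^T _ _]mxE -expr2.
by apply: (row_free_inj fB); rewrite vB0 mul0mx.
Qed.

(** With [B] a basis of the left kernel of [W], take [B^T (B B^T)^-1 B]; cyclicity reduces its trace
    to that of an identity matrix. *)
Lemma orthoproj_ker (R : realFieldType) m p (W : 'M[R]_(m, p)) :
  exists P : 'M[R]_m,
    [/\ P^T = P, P *m P = P, P *m W = 0 & \tr P = (m - \rank W)%:R].
Proof.
have [B [fB BW]] : exists B : 'M[R]_(\rank (kermx W), m), row_free B /\ B *m W = 0.
  exists (row_base (kermx W)); split; first exact: row_base_free.
  by apply/sub_kermxP; rewrite eq_row_base.
pose G := B *m B^T; have uG : G \in unitmx by apply: gram_unitmx.
have sG : G^T = G by rewrite /G trmx_mul trmxK.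
exists (B^T *m invmx G *m B); split.
- by rewrite !trmx_mul trmxK trmx_inv sG mulmxA.
- by rewrite -!mulmxA (mulmxA B) -/G mulKmx // mulmxA.
- by rewrite -mulmxA BW mulmx0.
- by rewrite mxtrace_mulC mulmxA mulmxV // mxtrace1 mxrank_ker.
Qed.

Lemma rank_diag_indicator (R : fieldType) n (B : {set 'I_n}) :
  (\rank (diag_mx (\row_i (i \in B)%:R : 'rV[R]_n)) <= #|B|)%N.
Proof.
pose T : 'M[R]_(#|B|, n) := rowsub enum_val 1%:M.
suff -> : diag_mx (\row_i (i \in B)%:R) = T^T *m T.
  by apply: leq_trans (mxrankM_maxr _ _) (rank_leq_row _).
apply/matrixP => i j; rewrite !mxE.
have -> : \sum_k T^T i k * T k j =
    \sum_(k : 'I_#|B|) (enum_val k == i)%:R * (enum_val k == j)%:R.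
  by apply: eq_bigr => k _; rewrite !mxE.
rewrite -(big_enum_val (A:=[in B]) (fun k => (k == i)%:R * (k == j)%:R)) /=.
case: (boolP (i \in B)) => iB.
  rewrite (bigD1 i) //= eqxx mul1r big1 ?addr0 // => k /andP[_ /negPf->].
  by rewrite mul0r.
rewrite mul0rn big1 // => k kB; case: eqP => [ki|_]; last by rewrite mul0r.
by rewrite -ki kB in iB.
Qed.

(** * The form [J] and coordinate projectors *)

Section Symplectic.
Variables (R : realType) (n : nat).
Implicit Types (e f : 'rV[R]_n) (M : 'M[R]_(n + n)) (I K : {set 'I_n}).
Local Notation J := (Jmat R n).

Lemma tr_Jmat : J^T = - J.
Proof. by rewrite /Jmat tr_block_mx opp_block_mx !linear0 linearN /= !trmx1 opprK. Qed.

Lemma Jmat_sqr : J *m J = - 1%:M.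
Proof.
rewrite /Jmat mulmx_block !mul0mx !mulmx0 !mul1mx !mulmx1 !add0r !addr0.
by rewrite [in RHS]scalar_mx_block opp_block_mx oppr0.
Qed.

Lemma mul_trJmat : J^T *m J = 1%:M.
Proof. by rewrite tr_Jmat mulNmx Jmat_sqr opprK. Qed.

Lemma mul_Jmat_tr : J *m J^T = 1%:M.
Proof. by rewrite tr_Jmat mulmxN Jmat_sqr opprK. Qed.

(** [J^T M^T J] is a left inverse of the square matrix [M], hence also a right inverse. *)
Lemma symplectic_tr M : symplectic M -> M *m J *m M^T = J.
Proof.
move=> sM; have /mulmx1C : (J^T *m M^T *m J) *m M = 1%:M.
  by rewrite -2!mulmxA (mulmxA M^T) sM mul_trJmat.
rewrite !mulmxA tr_Jmat mulmxN !mulNmx => /(congr1 (fun A => A *m J)).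
by rewrite /= mulNmx -(mulmxA _ J J) Jmat_sqr mulmxN opprK mulmx1 mul1mx.
Qed.

Lemma symplectic_mul M N : symplectic M -> symplectic N -> symplectic (M *m N).
Proof.
rewrite /symplectic => sM sN; rewrite -[RHS]sN -[in RHS]sM.
by rewrite trmx_mul !mulmxA.
Qed.

Lemma dblock_mul e f : dblock e *m dblock f = dblock (\row_i (e 0 i * f 0 i)).
Proof.
rewrite /dblock mulmx_block !mul0mx !mulmx0 !addr0 !add0r mulmx_diag.
by [].
Qed.

Lemma tr_dblock e : (dblock e)^T = dblock e.
Proof. by rewrite /dblock tr_block_mx !tr_diag_mx !linear0. Qed.

Lemma Jmat_dblock e : J *m dblock e = dblock e *m J.
Proof.
rewrite /Jmat /dblock !mulmx_block !mul0mx !mulmx0 !mul1mx !mulmx1.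
by rewrite !mulNmx !mulmxN mulmx1 mul1mx !add0r !addr0.
Qed.

(** The same mask on both halves selects coordinate pairs, which makes the projector commute with
    [J]. *)
Definition cproj K : 'M[R]_(n + n) := dblock (\row_i (i \in K)%:R).

Lemma cproj_idem K : cproj K *m cproj K = cproj K.
Proof.
rewrite /cproj dblock_mul; congr dblock; apply/rowP => i.
by rewrite !mxE -natrM; case: (_ \in _).
Qed.

Lemma tr_cproj K : (cproj K)^T = cproj K.
Proof. exact: tr_dblock. Qed.

Lemma Jmat_cproj K : J *m cproj K = cproj K *m J.
Proof. exact: Jmat_dblock. Qed.

Lemma cprojC K : 1%:M - cproj K = cproj (~: K).
Proof.
rewrite /cproj /dblock scalar_mx_block opp_block_mx add_block_mx !oppr0 !addr0.
suff -> : 1%:M - diag_mx (\row_i (i \in K)%:R)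
          = diag_mx (\row_i (i \in ~: K)%:R) :> 'M[R]_n by [].
apply/matrixP => i j; rewrite !mxE inE.
by case: (i == j); case: (i \in K); rewrite ?mulr1n ?mulr0n ?subrr ?subr0.
Qed.

Lemma rank_cproj K : (\rank (cproj K) <= #|K| + #|K|)%N.
Proof. by rewrite /cproj /dblock rank_diag_block_mx leq_add // rank_diag_indicator. Qed.

(* The rows in [I] of [M], cut to the columns outside [K], span a space of
   dimension at most [2(n - |K|)], so on a subspace of dimension at least
   [2(|I| + |K| - n)] the form [X J X^T] coincides with [J], where [X] is the
   remaining block; testing against the projector [P] on it bounds [tr X X^T]. *)
Lemma symplectic_block_trace M I K : symplectic M ->
  (#|I| + #|I| + (#|K| + #|K|))%:R - (n + n)%:R <=
    \tr ((cproj I *m M *m cproj K) *m (cproj I *m M *m cproj K)^T).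
Proof.
move=> sM; set X := _ *m cproj K; pose Y := cproj I *m M *m cproj (~: K).
(* This is [M J M^T = J] compressed to the rows in [I], the columns being split between [K] and its
   complement. *)
have XJX : X *m J *m X^T = cproj I *m J *m cproj I - Y *m J *m Y^T.
  rewrite -[X in _ = _ *m X *m _ - _](symplectic_tr _ sM) /X /Y !trmx_mul !tr_cproj.
  apply/eqP; rewrite eq_sym subr_eq eq_sym; apply/eqP.
  have E L : cproj I *m M *m cproj L *m J *m (cproj L *m (M^T *m cproj I))
     = cproj I *m M *m cproj L *m J *m (M^T *m cproj I).
    rewrite -(mulmxA _ (cproj L) J) -Jmat_cproj !mulmxA.
    by rewrite -(mulmxA _ (cproj L) (cproj L)) cproj_idem.
  rewrite !E -!mulmxA -mulmxDr -mulmxDr -mulmxDl -cprojC addrC subrK mul1mx.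
  by rewrite !mulmxA.
clearbody X.
(* [P] is supported on [I] and [P Y = 0], so that [P J^T X J X^T] has trace [tr P]. *)
have [P [sP PP PW trP]] := orthoproj_ker _ _ _ (row_mx (cproj (~: I)) Y).
move: PW; rewrite mul_mx_row -(row_mx0 _ _ _) => /eq_row_mx [PI PY].
have {}PI : P *m cproj I = P.
  by move: PI; rewrite -cprojC mulmxBr mulmx1 => /eqP; rewrite subr_eq0 => /eqP.
have YP : Y^T *m P = 0 by rewrite -[LHS]trmxK trmx_mul trmxK sP PY trmx0.
(* Expanding [0 <= tr (N - L)(N - L)^T] gives [2 tr P <= tr N N^T + tr L L^T], and both terms on the
   right are at most [tr X X^T]. *)
pose N := P *m J^T *m X; pose L := X *m J^T.
have trNL : \tr (N *m L^T) = \tr P.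
  have -> : N *m L^T = P *m J^T *m (X *m J *m X^T).
    by rewrite /N /L trmx_mul trmxK !mulmxA.
  rewrite XJX mulmxBr linearB /= -{1}Jmat_cproj.
  rewrite -(mulmxA J) cproj_idem mulmxA -(mulmxA P) mul_trJmat mulmx1 PI.
  by rewrite mxtrace_mulC -!mulmxA (mulmxA Y^T) YP mul0mx !mulmx0 mxtrace0 subr0.
have trLL : \tr (L *m L^T) = \tr (X *m X^T).
  by rewrite /L trmx_mul trmxK mulmxA -(mulmxA X) mul_trJmat mulmx1.
have trNN : \tr (N *m N^T) <= \tr (X *m X^T).
  have -> : \tr (X *m X^T) = \tr (J^T *m X *m (J^T *m X)^T).
    rewrite trmx_mul trmxK [RHS]mxtrace_mulC !mulmxA -(mulmxA X^T) mul_Jmat_tr.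
    by rewrite mulmx1 mxtrace_mulC.
  have sandwich (Q Z : 'M[R]_(n + n)) : Q^T = Q -> Q *m Q = Q ->
      \tr (Q *m Z *m (Q *m Z)^T) = \tr (Q *m (Z *m Z^T)).
    move=> sQ QQ; rewrite trmx_mul sQ mulmxA mxtrace_mulC -mulmxA (mulmxA Q) QQ.
    by rewrite mxtrace_mulC.
  have -> : N = P *m (J^T *m X) by rewrite /N mulmxA.
  move: (J^T *m X) => Z.
  have := mxtrace_gram_ge0 _ _ _ ((1%:M - P) *m Z).
  rewrite !sandwich //; last first.
  - by rewrite mulmxBr mulmx1 mulmxBl mul1mx PP subrr subr0.
  - by rewrite linearB /= trmx1 sP.
  by rewrite mulmxBl mul1mx linearB /= subr_ge0.
have := mxtrace_gram_ge0 _ _ _ (N - L).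
have -> : (N - L) *m (N - L)^T = N *m N^T - N *m L^T - (L *m N^T - L *m L^T).
  by rewrite linearB /= mulmxBl !mulmxBr.
have LN : \tr (L *m N^T) = \tr P by rewrite -mxtrace_tr trmx_mul trmxK.
rewrite !linearB /= trLL trNL LN => ge0.
have rk : (\rank (row_mx (cproj (~: I)) Y) <=
    (n - #|I| + (n - #|I|)) + (n - #|K| + (n - #|K|)))%N.
  rewrite -[row_mx _ _](_ : row_mx (cproj (~: I)) 0 + row_mx 0 Y = _); last first.
    by rewrite add_row_mx addr0 add0r.
  apply: leq_trans (mxrank_add _ _) _; rewrite rank_row_mx0 rank_row_0mx.
  have cK : #|~: K| = (n - #|K|)%N by rewrite cardsCs setCK card_ord.
  have cI : #|~: I| = (n - #|I|)%N by rewrite cardsCs setCK card_ord.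
  rewrite -cK -cI leq_add ?rank_cproj //.
  by apply: leq_trans (mxrankM_maxr _ _) (rank_cproj _).
have leI : (#|I| <= n)%N by rewrite -[leqRHS]card_ord max_card.
have leK : (#|K| <= n)%N by rewrite -[leqRHS]card_ord max_card.
apply: le_trans (_ : \tr P <= _); last by lra.
rewrite trP lerBlDr -natrD ler_nat.
have := rank_leq_row (row_mx (cproj (~: I)) Y).
move: rk leI leK; move: #|I| #|K| (\rank _) => i k r; clear; lia.
Qed.

End Symplectic.
Arguments cproj {R n}.

(** * Majorisation *)

(* Lowering one coordinate at a time until it lies in a tight set; tight sets
   are stable under union because [f] is supermodular. *)
Lemma supermodular_base (R : realFieldType) n (f : {set 'I_n} -> R)
    (x : 'rV[R]_n) :
  f set0 = 0 ->
  (forall A B, f A + f B <= f (A :|: B) + f (A :&: B)) ->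
  (forall A : {set 'I_n}, f A <= \sum_(i in A) x 0 i) ->
  exists z : 'rV[R]_n, [/\ forall i, z 0 i <= x 0 i,
    forall A : {set 'I_n}, f A <= \sum_(i in A) z 0 i & \sum_i z 0 i = f setT].
Proof.
move=> f0 fsup fx.
have lower (s : seq 'I_n) : exists z : 'rV[R]_n, [/\ forall i, z 0 i <= x 0 i,
    forall A : {set 'I_n}, f A <= \sum_(i in A) z 0 i
  & forall i, i \in s ->
      exists2 A : {set 'I_n}, i \in A & \sum_(i in A) z 0 i = f A].
  elim: s => [|a s [z [zx fz ztight]]]; first by exists x.
  pose g (A : {set 'I_n}) := \sum_(i in A) z 0 i - f A.
  (* [T] has the least slack among the sets containing [a]; lowering coordinate [a] by it makes [T]
     tight and violates no bound. *)
  have [T aT Tmin] := @arg_minP _ R _ setT (fun A : {set 'I_n} => a \in A) g (in_setT a).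
  have gT : 0 <= g T by rewrite subr_ge0.
  pose z' : 'rV[R]_n := \row_i (z 0 i - g T *+ (i == a)).
  have sz' A : \sum_(i in A) z' 0 i = \sum_(i in A) z 0 i - g T *+ (a \in A).
    under eq_bigr do rewrite mxE.
    rewrite sumrB; congr (_ - _).
    case: (boolP (a \in A)) => aA; last first.
      rewrite big1 // => i iA; case: eqP => // ia.
      by rewrite -ia iA in aA.
    by rewrite (bigD1 a) //= eqxx big1 ?addr0 // => i /andP[_ /negPf->].
  exists z'; split.
  - by move=> i; rewrite mxE (le_trans _ (zx i)) // lerBlDr lerDl mulrn_wge0.
  - move=> A; rewrite sz'; case: (boolP (a \in A)) => aA; last by rewrite subr0.
    by have := Tmin A aA; rewrite mulr1n /g; lra.
  - move=> i; rewrite inE => /predU1P[->|/ztight [A iA eA]].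
      by exists T => //; rewrite sz' aT mulr1n /g; lra.
    (* If a tight set contains [a], then [g T = 0] and nothing is lowered. *)
    exists A => //; rewrite sz' eA; case: (boolP (a \in A)) => aA; last by rewrite subr0.
    by have := Tmin A aA; rewrite /g in gT *; rewrite mulr1n eA; lra.
have [z [zx fz ztight]] := lower (enum 'I_n).
exists z; split=> //.
have {ztight} : forall s : seq 'I_n, exists2 A : {set 'I_n},
    {subset s <= A} & \sum_(i in A) z 0 i = f A.
  elim=> [|a s [B sB eB]]; first by exists set0; rewrite ?big_set0.
  have [A aA eA] := ztight a (mem_enum _ _).
  exists (A :|: B).
    by move=> i; rewrite !inE => /predU1P[->|/sB->]; rewrite ?aA ?orbT.
  have := fsup A B; have := fz (A :|: B); have := fz (A :&: B).
  have : \sum_(i in A :|: B) z 0 i + \sum_(i in A :&: B) z 0 i =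
      \sum_(i in A) z 0 i + \sum_(i in B) z 0 i.
    rewrite (big_setID A) /= [X in _ = _ + X](big_setID A) /=.
    rewrite setUK setIC.
    have -> : (A :|: B) :\: A = B :\: A by rewrite setDUl setDv set0U.
    by rewrite setIC (setIC A B); ring.
  by rewrite eA eB; lra.
case/(_ (enum 'I_n)) => A sA.
have -> : A = setT by apply/setP => i; rewrite sA ?mem_enum // inE.
move=> <-; by apply: eq_bigl => i; rewrite inE.
Qed.

(** Induction on the number of coordinates where [z] and [b] differ. Prefix sums of [b] are taken in
    place because a transfer can disturb its order. *)
Lemma robin_hood_closed (R : realFieldType) n (P : 'rV[R]_n -> Prop)
    (z b : 'rV[R]_n) :
  (forall (c : 'rV[R]_n) i j t, P c -> 0 <= t <= c 0 i - c 0 j -> i != j ->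
     P (\row_k (c 0 k - t *+ (k == i) + t *+ (k == j)))) ->
  (forall i j : 'I_n, (i <= j)%N -> z 0 j <= z 0 i) ->
  (forall k, \sum_(i < n | (i < k)%N) z 0 i <= \sum_(i < n | (i < k)%N) b 0 i) ->
  \sum_i z 0 i = \sum_i b 0 i ->
  P b -> P z.
Proof.
move=> Pclosed zdec; have [m] := ubnP #|[set i | z 0 i != b 0 i]|.
elim: m b => // m IHm b; rewrite ltnS => bm pre tot Pb.
have [->//|zb] := eqVneq z b.
have [j0 j0P] : exists j, b 0 j < z 0 j.
  apply/existsP; apply: contraR zb; rewrite negb_exists => /forallP zb.
  have {}zb i : z 0 i <= b 0 i by rewrite leNgt zb.
  apply/eqP/rowP => i; apply/eqP; rewrite eq_sym -subr_eq0.
  have : \sum_i (b 0 i - z 0 i) == 0 by rewrite sumrB tot subrr.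
  rewrite psumr_eq0; last by move=> k _; rewrite subr_ge0.
  by move/allP/(_ i (mem_index_enum _)).
(* At the first coordinate [j] where [b] falls short of [z], the prefix sum through [j] forces an
   excess at some earlier [i]. *)
have [j jP jmin] := @arg_minnP _ j0 (fun j => b 0 j < z 0 j) val j0P.
have {j0 j0P} bge (i : 'I_n) : (i < j)%N -> z 0 i <= b 0 i.
  by rewrite leNgt; apply: contraL => /jmin; rewrite -leqNgt.
have [i ij iP] : exists2 i : 'I_n, (i < j)%N & z 0 i < b 0 i.
  have [i /andP[]|none] := pickP [pred i : 'I_n | (i < j)%N && (z 0 i < b 0 i)].
    by exists i.
  have := pre j.+1.
  have split (c : 'rV[R]_n) : \sum_(i < n | (i < j.+1)%N) c 0 i =
      c 0 j + \sum_(i < n | (i < j)%N) c 0 i.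
    rewrite (bigD1 j) //=; congr (_ + _); apply: eq_bigl => k.
    by rewrite -val_eqE /=; lia.
  rewrite !split.
  have -> : \sum_(i < n | (i < j)%N) b 0 i = \sum_(i < n | (i < j)%N) z 0 i.
    apply: eq_bigr => k kj; apply/eqP; rewrite eq_le bge // andbT leNgt.
    by have := none k; rewrite /= kj /= => ->.
  by rewrite lerD2r leNgt jP.
(* The largest transfer from [i] to [j] that overshoots neither target; it makes one of the two
   coordinates agree with [z]. *)
pose t := Num.min (b 0 i - z 0 i) (z 0 j - b 0 j).
have t0 : 0 <= t by rewrite /t le_min !subr_ge0 !ltW.
have ti : t <= b 0 i - z 0 i by rewrite /t ge_min lexx.
have tj : t <= z 0 j - b 0 j by rewrite /t ge_min lexx orbT.
have nij : i != j by rewrite -val_eqE /= ltn_eqF.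
pose b' : 'rV[R]_n := \row_k (b 0 k - t *+ (k == i) + t *+ (k == j)).
have sb' (Q : pred 'I_n) : \sum_(k | Q k) b' 0 k =
    \sum_(k | Q k) b 0 k - t *+ Q i + t *+ Q j.
  have one l : \sum_(k | Q k) t *+ (k == l) = t *+ Q l.
    rewrite big_mkcond (bigD1 l) //= eqxx big1 ?addr0; first by case: (Q l).
    by move=> k /negPf->; rewrite if_same.
  under eq_bigr do rewrite mxE.
  by rewrite big_split sumrB /= !one.
apply: (IHm b'); last first.
- apply: Pclosed => //; rewrite t0 /=.
  by have := zdec _ _ (ltnW ij); lra.
- by rewrite sb' /= tot mulr1n subrK.
- move=> k; rewrite sb'.
  (* Only prefixes containing [i] but not [j] lose [t], and there [b'] still dominates [z]
     coordinatewise. *)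
  have [kj|jk] := leqP k j; last by rewrite (ltn_trans ij jk) mulr1n subrK pre.
  rewrite addr0.
  have [ik|ki] := ltnP i k; last by rewrite subr0 pre.
  rewrite mulr1n (bigD1 i) //=
    [leRHS](_ : _ = (b 0 i - t) + \sum_(l < n | (l < k)%N && (l != i)) b 0 l).
    apply: lerD; first by lra.
    by apply: ler_sum => l /andP[lk _]; apply: bge; apply: leq_trans lk kj.
  by rewrite (bigD1 i) //=; ring.
- apply: leq_trans bm; apply: proper_card; apply/properP; split.
    apply/subsetP => k; rewrite !inE mxE; apply: contra => /eqP zk.
    have ki : k != i by apply: contraTneq iP => <-; rewrite zk ltxx.
    have kj : k != j by apply: contraTneq jP => <-; rewrite zk ltxx.
    by rewrite (negPf ki) (negPf kj) subr0 addr0 zk.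
  have [le|le] := leP (b 0 i - z 0 i) (z 0 j - b 0 j).
    exists i; rewrite inE; first by rewrite lt_eqF.
    rewrite mxE eqxx (negPf nij) /t (min_idPl le).
    by rewrite negbK mulr1n mulr0n; apply/eqP; ring.
  exists j; rewrite inE; first by rewrite gt_eqF.
  rewrite mxE eqxx (eq_sym j) (negPf nij) /t (min_idPr (ltW le)).
  by rewrite negbK mulr1n mulr0n; apply/eqP; ring.
Qed.

(** Summation by parts, as an induction on the sharper lower bound: last coefficient times total of
    [v]. *)
Lemma abel_sum_ge0 (R : realDomainType) n (a : nat -> R) (v : 'I_n -> R) :
  (forall i, 0 <= a i) -> (forall i, a i.+1 <= a i) ->
  (forall l, 0 <= \sum_(i < n | (i < l)%N) v i) ->
  0 <= \sum_(i < n) a i * v i.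
Proof.
move=> a0 adec; case: n v => [|n] v V0; first by rewrite big_ord0.
have tot m (u : 'I_m -> R) : \sum_(i < m | (i < m)%N) u i = \sum_i u i.
  by apply: eq_bigl => i; rewrite ltn_ord.
apply: (@le_trans _ _ (a n * \sum_i v i)); first by rewrite mulr_ge0 // -tot.
elim: n v V0 => [|n IHn] v V0; first by rewrite !big_ord1.
pose v' i := v (widen_ord (leqnSn n.+1) i).
have V0' l : 0 <= \sum_(i < n.+1 | (i < l)%N) v' i.
  have := V0 (minn l n.+1); rewrite big_mkcond big_ord_recr /= ltnNge geq_minr addr0.
  rewrite -big_mkcond; congr (_ <= _); apply: eq_bigl => i.
  by rewrite /= leq_min ltn_ord andbT.
rewrite big_ord_recr [leRHS]big_ord_recr /= mulrDr lerD2r.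
apply: le_trans (IHn _ V0').
by rewrite ler_wpM2r // -tot.
Qed.

Lemma card_ord_ltn n m : (m <= n)%N -> #|[set i : 'I_n | (i < m)%N]| = m.
Proof.
move=> mn; rewrite -sum1dep_card -(big_ord_widen n (fun=> 1%N) mn).
by rewrite sum1_card card_ord.
Qed.

(** * Sums of the smallest entries *)

Section Sorting.
Variables (R : realType) (n : nat).
Implicit Types (x z d : 'rV[R]_n).

Lemma size_decr x : size (decr x) = n.
Proof. by rewrite /decr size_sort size_map -cardT card_ord. Qed.

Lemma decr_perm x : exists s : 'S_n, forall i : 'I_n, (decr x)`_i = x 0 (s i).
Proof.
have /tuple_permP[s es] : perm_eq (decr x) [tuple x 0 i | i < n].
  by rewrite /decr perm_sort.
exists s => i; rewrite es (nth_map i) ?size_enum_ord //.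
by rewrite tnth_mktuple nth_ord_enum.
Qed.

Lemma decr_nth x i j : (i <= j < n)%N -> (decr x)`_j <= (decr x)`_i.
Proof.
case/andP=> ij jn.
have srt : sorted (fun a b : R => b <= a) (decr x).
  by apply: sort_sorted => a b; apply: le_total.
have tr : transitive (fun a b : R => b <= a) by move=> a b c ba ac; apply: le_trans ac ba.
by apply: (sorted_leq_nth tr _ 0 srt); rewrite ?inE ?size_decr ?(leq_ltn_trans ij).
Qed.

Definition small_sum d k : R := \sum_(i < n | (n - k <= i)%N) (decr d)`_i.

Lemma small_sum0 d : small_sum d 0 = 0.
Proof. by rewrite /small_sum big1 // => i; rewrite subn0 leqNgt ltn_ord. Qed.

Lemma sum_decr d : \sum_(i < n) (decr d)`_i = \sum_i d 0 i.
Proof.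
have [s es] := decr_perm d; under eq_bigr do rewrite es.
by rewrite [RHS](reindex_inj (@perm_inj _ s)).
Qed.

Lemma small_sumT d : small_sum d n = \sum_i d 0 i.
Proof. by rewrite -sum_decr; apply: eq_bigl => i; rewrite subnn. Qed.

Lemma small_sumS d k : (k < n)%N ->
  small_sum d k.+1 = (decr d)`_(n - k.+1) + small_sum d k.
Proof.
move=> kn; have kn' : (n - k.+1 < n)%N by lia.
rewrite /small_sum (bigD1 (Ordinal kn')) //=; congr (_ + _).
by apply: eq_bigl => i; rewrite -val_eqE /=; lia.
Qed.

(** The increments of [small_sum d] are the entries of [d] in increasing order. *)
Lemma small_sum_convex d i a m : (i <= a)%N -> (a + m <= n)%N ->
  small_sum d (i + m) + small_sum d a <= small_sum d (a + m) + small_sum d i.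
Proof.
move=> ia; elim: m => [|m IHm] am; first by rewrite !addn0 addrC.
have {}IHm := IHm ltac:(lia).
rewrite !addnS !small_sumS; try lia.
have : (decr d)`_(n - (i + m).+1) <= (decr d)`_(n - (a + m).+1).
  by apply: decr_nth; lia.
by lra.
Qed.

(** Convexity at the cardinals: [#|A| + #|B| = #|A :|: B| + #|A :&: B|], the intersection being the
    smallest. *)
Lemma small_sum_supermodular d (A B : {set 'I_n}) :
  small_sum d #|A| + small_sum d #|B| <=
  small_sum d #|A :|: B| + small_sum d #|A :&: B|.
Proof.
have := cardsUI A B.
have := subset_leq_card (subsetIl A B); have := subset_leq_card (subsetIr A B).
have : (#|A :|: B| <= n)%N by rewrite -[leqRHS]card_ord max_card.
move: #|A :|: B| #|A :&: B| #|A| #|B| => u i a b un ib ia e.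
have -> : b = (i + (b - i))%N by lia.
have -> : u = (a + (b - i))%N by lia.
by rewrite addrC small_sum_convex //; lia.
Qed.

Lemma sum_decr_prefix x k : (k <= n)%N -> exists2 A : {set 'I_n}, #|A| = k &
  \sum_(i < k) (decr x)`_i = \sum_(i in A) x 0 i.
Proof.
move=> kn; have [s es] := decr_perm x.
exists (s @: [set i : 'I_n | (i < k)%N]).
  by rewrite card_imset ?card_ord_ltn //; apply: perm_inj.
rewrite (big_ord_widen n (fun i => (decr x)`_i) kn).
rewrite big_imset /=; last by move=> ? ? _ _; apply: perm_inj.
by apply: eq_big => [i|i _]; rewrite ?inE.
Qed.

(** Once [x] is lowered to [z] with the total of [d], a lower bound on a complement becomes the
    upper bound that majorisation asks for. *)
Lemma small_sum_Sigma d x :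
  (forall A : {set 'I_n}, small_sum d #|A| <= \sum_(i in A) x 0 i) -> Sigma d x.
Proof.
move=> dx.
have [|A B|A|z [zx dz totz]] :=
    @supermodular_base R n (fun A => small_sum d #|A|) x _ _ _.
- by rewrite cards0 small_sum0.
- exact: small_sum_supermodular.
- exact: dx.
rewrite cardsT card_ord small_sumT in totz.
exists z; split=> //; split; last by rewrite !sum_decr.
move=> k kn; have [A Ak ->] := sum_decr_prefix z k kn.
have := dz (~: A); rewrite cardsCs setCK card_ord Ak /small_sum subKn // => dzA.
rewrite (big_ord_widen n (fun i => (decr d)`_i) kn).
have : \sum_(i in A) z 0 i + \sum_(i in ~: A) z 0 i =
    \sum_(i < n | (i < k)%N) (decr d)`_i + \sum_(i < n | (k <= i)%N) (decr d)`_i.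
  transitivity (\sum_i z 0 i).
    by rewrite [RHS](bigID (mem A)) /=; congr (_ + _); apply: eq_bigl => i; rewrite ?inE.
  rewrite totz -sum_decr [LHS](bigID (fun i : 'I_n => (i < k)%N)) /=.
  by congr (_ + _); apply: eq_bigl => i; rewrite -leqNgt.
by lra.
Qed.

(* The weights [w] are only known through the lower bounds
   [|K| - (n - m) <= w(K)]; summation by parts against the decreasing
   rearrangement of [d] turns these into the bound. *)
Lemma small_sum_weighted d (w : 'I_n -> R) m : (m <= n)%N ->
  (forall i, 0 <= d 0 i) -> (forall i, 0 <= w i) ->
  (forall K : {set 'I_n}, (m + #|K|)%:R - n%:R <= \sum_(k in K) w k) ->
  small_sum d m <= \sum_k d 0 k * w k.
Proof.
move=> mn d0 w0 wK; have [s es] := decr_perm d.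
rewrite -subr_ge0 [X in X - _](reindex_inj (@perm_inj _ s)) /=.
rewrite /small_sum [X in _ - X]big_mkcond -sumrB /=.
have -> : \sum_(i < n) (d 0 (s i) * w (s i) -
       (if (n - m <= i)%N then (decr d)`_i else 0)) =
    \sum_(i < n) (decr d)`_i * (w (s i) - (n - m <= i)%N%:R).
  apply: eq_bigr => i _; rewrite -es mulrBr; congr (_ - _).
  by case: ifP; rewrite ?mulr1 ?mulr0.
(* Past the end [nth] returns 0, so the coefficients stay nonnegative and nonincreasing on all
   naturals. *)
apply: abel_sum_ge0 => [i|i|l].
- have [ni|ni] := leqP n i; first by rewrite nth_default ?size_decr.
  by rewrite (es (Ordinal ni)).
- have [ni|ni] := leqP n i.+1; last by apply: decr_nth; rewrite leqnSn.
  rewrite nth_default ?size_decr //.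
  have [ni'|ni'] := leqP n i; first by rewrite nth_default ?size_decr.
  by rewrite (es (Ordinal ni')).
rewrite sumrB subr_ge0 -natr_sum.
have -> : \sum_(i < n | (i < l)%N) w (s i) =
    \sum_(k in s @: [set i : 'I_n | (i < l)%N]) w k.
  rewrite big_imset /=; last by move=> ? ? _ _; apply: perm_inj.
  by apply: eq_bigl => i; rewrite inE.
set K := s @: _; set c := (\sum_(i < n | _) _)%N.
(* Places below [n - m] have nothing subtracted, so [w >= 0] suffices; beyond them [wK K] gives
   exactly [c]. *)
have [lm|ml] := leqP l (n - m).
  rewrite [c]big1 ?sumr_ge0 // => i il.
  by rewrite leqNgt (leq_trans il lm).
apply: le_trans (wK K); rewrite lerBrDr -natrD ler_nat.
have -> : #|K| = (c + (n - m))%N.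
  rewrite card_imset; last exact: perm_inj.
  rewrite -sum1dep_card (bigID (fun i : 'I_n => (n - m <= i)%N)) /=; congr (_ + _)%N.
    rewrite /c [RHS]big_mkcond [LHS]big_mkcondr -big_mkcond.
    by apply: eq_bigr => i _; case: ifP.
  rewrite sum1dep_card -[RHS](@card_ord_ltn n) ?leq_subr //.
  by apply: eq_card => i; rewrite !inE -ltnNge; lia.
lia.
Qed.

End Sorting.
Arguments small_sum {R n}.

(** * Diagonals of orthogonal conjugates *)

(** For [q < t], the ratio [u = s / c] solves [(t - q) u^2 - 2 r u - (p - t) = 0], whose reduced
    discriminant [D] is nonnegative. *)
Lemma rotation_exists (R : rcfType) (p q r t : R) : q <= t <= p ->
  exists c s, c ^+ 2 + s ^+ 2 = 1 /\
    c ^+ 2 * p + 2 * c * s * r + s ^+ 2 * q = t.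
Proof.
case/andP; rewrite le_eqVlt => /predU1P[<- _|qt tp].
  by exists 0, 1; split; ring.
pose D := r ^+ 2 + (t - q) * (p - t).
have D0 : 0 <= D by rewrite addr_ge0 ?sqr_ge0 ?mulr_ge0 ?subr_ge0 // ltW.
pose u := (r + Num.sqrt D) / (t - q).
have tq : t - q != 0 by rewrite subr_eq0 gt_eqF.
have eu : (t - q) * u ^+ 2 = 2 * r * u + (p - t).
  have := sqr_sqrtr D0; rewrite /u; set w := Num.sqrt D => ew.
  have : w ^+ 2 - D = 0 by rewrite ew subrr.
  rewrite /D => {}ew; apply/eqP; rewrite -subr_eq0.
  suff -> : (t - q) * ((r + w) / (t - q)) ^+ 2 -
    (2 * r * ((r + w) / (t - q)) + (p - t)) =
    (w ^+ 2 - (r ^+ 2 + (t - q) * (p - t))) / (t - q) by rewrite ew mul0r.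
  by field.
have u1 : 0 < 1 + u ^+ 2 by rewrite ltr_wpDr ?sqr_ge0.
have c2 := sqr_sqrtr (ltW u1); set k := Num.sqrt _ in c2.
have k0 : k != 0 by apply: contraTneq u1 => k0; rewrite -c2 k0 expr0n ltxx.
exists k^-1, (u / k); split.
  by rewrite expr_div_n exprVn c2; field; rewrite gt_eqF.
have -> : k^-1 ^+ 2 * p + 2 * k^-1 * (u / k) * r + (u / k) ^+ 2 * q =
  (p + 2 * r * u + q * u ^+ 2) / k ^+ 2 by field.
rewrite c2; apply: (canLR (mulfK _)); first by rewrite gt_eqF.
by move: eu; rewrite mulrBl => /eqP; rewrite subr_eq => /eqP eu; rewrite mulrDr eu; ring.
Qed.

Section Horn.
Variables (R : rcfType) (n : nat).
Implicit Types (e b : 'rV[R]_n) (O : 'M[R]_n).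

Definition rot_diag e b : Prop :=
  exists2 O : 'M[R]_n, O *m O^T = 1%:M &
    forall i, (O *m diag_mx e *m O^T) i i = b 0 i.

(** Weight [e] gives the entries of the conjugate and weight [1] the inner products of rows, so one
    rotation identity serves both. *)
Let form e (u v : 'I_n -> R) := \sum_l u l * e 0 l * v l.

Local Lemma formE e O i k : (O *m diag_mx e *m O^T) i k = form e (O i) (O k).
Proof. by rewrite mxE; apply: eq_bigr => l _; rewrite mul_mx_diag !mxE. Qed.

Local Lemma formC e u v : form e u v = form e v u.
Proof. by apply: eq_bigr => l _; ring. Qed.

Local Lemma formDl e a c u v w :
  form e (fun l => a * u l + c * v l) w = a * form e u w + c * form e v w.
Proof.
by rewrite /form !mulr_sumr -big_split; apply: eq_bigr => l _; rewrite /=; ring.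
Qed.

Local Lemma orthoP O : O *m O^T = 1%:M <->
  forall i k, form (const_mx 1) (O i) (O k) = (i == k)%:R.
Proof.
split=> [OO i k|OO]; first by rewrite -formE diag_const_mx mulmx1 OO mxE.
by apply/matrixP => i k; rewrite [RHS]mxE -OO -formE diag_const_mx mulmx1.
Qed.

Lemma rot_diag_id e : rot_diag e e.
Proof.
exists 1%:M => [|i]; first by rewrite trmx1 mulmx1.
by rewrite trmx1 mulmx1 mul1mx mxE eqxx.
Qed.

Lemma rot_diag_perm e b (s : 'S_n) :
  rot_diag e b -> rot_diag e (\row_i b 0 (s i)).
Proof.
case=> O OO Ob; exists (row_perm s O) => [|i].
  apply/orthoP => i k; rewrite -(inj_eq (@perm_inj _ s)) -(orthoP O).1 //.
  by apply: eq_bigr => l _; rewrite !mxE.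
by rewrite formE !mxE -Ob formE; apply: eq_bigr => l _; rewrite !mxE.
Qed.

(** Rotating rows [i] and [j] of [O] brings the [i]-th diagonal entry to [b 0 i - t]; the sum of the
    two entries is preserved, so the [j]-th gains [t]. *)
Lemma rot_diag_robin_hood e b i j t :
  rot_diag e b -> 0 <= t <= b 0 i - b 0 j -> i != j ->
  rot_diag e (\row_k (b 0 k - t *+ (k == i) + t *+ (k == j))).
Proof.
case=> O OO Ob tb nij.
have : b 0 j <= b 0 i - t <= b 0 i by lra.
case/(@rotation_exists R _ _ (form e (O i) (O j))) => c [s [cs1 cst]].
pose O' : 'M[R]_n := \matrix_(a, l)
  (if a == i then c * O i l + s * O j l
   else if a == j then (- s) * O i l + c * O j l else O a l).
have Oi l : O' i l = c * O i l + s * O j l by rewrite mxE eqxx.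
have Oj l : O' j l = (- s) * O i l + c * O j l by rewrite mxE eq_sym (negPf nij) eqxx.
have Ok a l : a != i -> a != j -> O' a l = O a l.
  by move=> /negPf ai /negPf aj; rewrite mxE ai aj.
have eqform f u u' v v' : u =1 u' -> v =1 v' -> form f u v = form f u' v'.
  by move=> eu ev; apply: eq_bigr => l _; rewrite eu ev.
have fii f : form f (O' i) (O' i) = c ^+ 2 * form f (O i) (O i)
    + 2 * c * s * form f (O i) (O j) + s ^+ 2 * form f (O j) (O j).
  rewrite (eqform _ _ _ _ _ Oi Oi) formDl 2!(formC _ _ (fun l => _ + _)) !formDl.
  by rewrite (formC _ (O j) (O i)); ring.
have fjj f : form f (O' j) (O' j) = s ^+ 2 * form f (O i) (O i)
    - 2 * c * s * form f (O i) (O j) + c ^+ 2 * form f (O j) (O j).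
  rewrite (eqform _ _ _ _ _ Oj Oj) formDl 2!(formC _ _ (fun l => _ + _)) !formDl.
  by rewrite (formC _ (O j) (O i)); ring.
have fij f : form f (O' i) (O' j) = (c ^+ 2 - s ^+ 2) * form f (O i) (O j)
    + c * s * (form f (O j) (O j) - form f (O i) (O i)).
  rewrite (eqform _ _ _ _ _ Oi Oj) formDl 2!(formC _ _ (fun l => _ + _)) !formDl.
  by rewrite (formC _ (O j) (O i)); ring.
have one a k : form (const_mx 1) (O a) (O k) = (a == k)%:R.
  by move: a k; apply/orthoP.
exists O' => [|k].
  apply/orthoP => a k.
  have fik k' : k' != i -> k' != j ->
      form (const_mx 1) (O' i) (O' k') = 0 /\ form (const_mx 1) (O' j) (O' k') = 0.
    move=> ki kj; have Ok' l := Ok k' l ki kj.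
    rewrite (eqform _ _ _ _ _ Oi Ok') (eqform _ _ _ _ _ Oj Ok') !formDl !one.
    by rewrite !(eq_sym _ k') (negPf ki) (negPf kj) !mulr0 addr0.
  have [->|ai] := eqVneq a i.
    have [->|ki] := eqVneq k i.
      by rewrite fii !one !eqxx (negPf nij) mulr0 addr0 !mulr1.
    have [->|kj] := eqVneq k j.
      by rewrite fij !one !eqxx (negPf nij) subrr !mulr0 addr0.
    by rewrite (fik k ki kj).1.
  have [->|aj] := eqVneq a j.
    have [->|ki] := eqVneq k i.
      by rewrite formC fij !one !eqxx ?(eq_sym j) (negPf nij) subrr !mulr0 addr0.
    have [->|kj] := eqVneq k j.
      by rewrite fjj !one !eqxx (negPf nij) mulr0 subr0 !mulr1 addrC.
    by rewrite (fik k ki kj).2.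
  have [->|ki] := eqVneq k i; first by rewrite formC (fik a ai aj).1 (negPf ai).
  have [->|kj] := eqVneq k j; first by rewrite formC (fik a ai aj).2 (negPf aj).
  by rewrite (eqform _ _ (O a) _ (O k)) ?one // => l; apply: Ok.
have fe a : form e (O a) (O a) = b 0 a by rewrite -formE Ob.
rewrite formE mxE.
have [->|ki] := eqVneq k i.
  by rewrite fii (negPf nij) mulr1n mulr0n addr0 -cst !fe.
have [->|kj] := eqVneq k j.
  rewrite fjj !fe mulr1n mulr0n subr0.
  have : c ^+ 2 = 1 - s ^+ 2 by rewrite -cs1 addrK.
  by move=> c2; move: cst; rewrite c2; lra.
by rewrite (eqform _ _ (O k) _ (O k)) ?fe ?subr0 ?addr0 // => l; apply: Ok.
Qed.

End Horn.
Arguments rot_diag {R n}.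

(** Transfers lead from the sorted [d] to the sorted [z]; a final permutation restores the order of
    [z]. *)
Lemma majorized_rot_diag (R : realType) n (z d : 'rV[R]_n) :
  majorized z d -> rot_diag d z.
Proof.
case=> zd tot; have [s es] := decr_perm _ _ z; have [u eu] := decr_perm _ _ d.
have : rot_diag d (\row_i z 0 (s i)).
  apply: (@robin_hood_closed _ _ _ _ (\row_i d 0 (u i))).
  - by move=> c i j t Pc tc nij; apply: rot_diag_robin_hood.
  - by move=> i j ij; rewrite !mxE -!es decr_nth // ij ltn_ord.
  - move=> k; under eq_bigr do rewrite mxE -es.
    under [leRHS]eq_bigr do rewrite mxE -eu.
    have lek (i : 'I_n) : (i < k)%N = (i < minn k n)%N by rewrite leq_min ltn_ord andbT.
    rewrite !(eq_bigl _ _ lek).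
    rewrite -(big_ord_widen n (fun i => (decr z)`_i)) ?geq_minr //.
    rewrite -(big_ord_widen n (fun i => (decr d)`_i)) ?geq_minr //.
    by rewrite zd // geq_minr.
  - under eq_bigr do rewrite mxE -es.
    by under [RHS]eq_bigr do rewrite mxE -eu.
  - exact/rot_diag_perm/rot_diag_id.
move/(rot_diag_perm _ _ _ _ (s^-1)%g).
by congr rot_diag; apply/rowP => i; rewrite !mxE permKV.
Qed.

(** * Symplectic orbits *)

Lemma mul_mx_diagE (R : comNzRingType) m n (A : 'M[R]_(m, n)) (v : 'rV[R]_n) i j :
  (A *m diag_mx v) i j = A i j * v 0 j.
Proof. by rewrite mul_mx_diag mxE. Qed.

Lemma mul_diag_mxE (R : comNzRingType) m n (v : 'rV[R]_m) (A : 'M[R]_(m, n)) i j :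
  (diag_mx v *m A) i j = v 0 i * A i j.
Proof. by rewrite mul_diag_mx mxE. Qed.

Section Orbit.
Variables (R : realType) (n : nat).
Implicit Types (M : 'M[R]_(n + n)) (d x z : 'rV[R]_n).

Lemma dblock_diag_mx d : dblock d = diag_mx (row_mx d d).
Proof. by rewrite diag_mx_row. Qed.

Lemma orbit_diagE M d a : (M *m dblock d *m M^T) a a =
  \sum_k d 0 k * (M a (lshift n k) ^+ 2 + M a (rshift n k) ^+ 2).
Proof.
rewrite mxE big_split_ord /= -big_split /=; apply: eq_bigr => k _ /=.
by rewrite dblock_diag_mx !mul_mx_diagE ![M^T _ _]mxE row_mxEl row_mxEr; ring.
Qed.

Lemma symplectic_block_weight M (I K : {set 'I_n}) : symplectic M ->
  (#|I| + #|I| + (#|K| + #|K|))%:R - (n + n)%:R <=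
  \sum_(j in I) \sum_(k in K)
    ((M (lshift n j) (lshift n k) ^+ 2 + M (lshift n j) (rshift n k) ^+ 2) +
     (M (rshift n j) (lshift n k) ^+ 2 + M (rshift n j) (rshift n k) ^+ 2)).
Proof.
move=> sM; apply: le_trans (symplectic_block_trace _ _ _ I K sM) _.
rewrite le_eqVlt; apply/orP; left; apply/eqP.
set X := cproj I *m M *m cproj K.
have XE a b : X a b = row_mx (\row_i (i \in I)%:R) (\row_i (i \in I)%:R) 0 a *
    M a b * row_mx (\row_i (i \in K)%:R) (\row_i (i \in K)%:R) 0 b.
  by rewrite /X /cproj !dblock_diag_mx mul_mx_diagE mul_diag_mxE.
have XX a : (X *m X^T) a a = \sum_k (X a (lshift n k) ^+ 2 + X a (rshift n k) ^+ 2).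
  rewrite mxE big_split_ord /= -big_split /=; apply: eq_bigr => k _ /=.
  by rewrite ![X^T _ _]mxE.
rewrite /mxtrace big_split_ord /= -big_split [RHS]big_mkcond /=.
apply: eq_bigr => j _; rewrite !XX -big_split.
transitivity (\sum_k if (j \in I) && (k \in K) then
    ((M (lshift n j) (lshift n k) ^+ 2 + M (lshift n j) (rshift n k) ^+ 2) +
     (M (rshift n j) (lshift n k) ^+ 2 + M (rshift n j) (rshift n k) ^+ 2)) else 0).
  apply: eq_bigr => k _ /=; rewrite !XE !row_mxEl !row_mxEr !mxE.
  case: (j \in I) => /=; last by rewrite !mul0r expr0n /= !addr0.
  by case: (k \in K); rewrite ?mul1r ?mulr1 // !mulr0 expr0n /= !addr0.
by case: (j \in I) => /=; rewrite -?big_mkcond // big1.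
Qed.

(** Half the squared entries, summed over the rows in [I], are weights to which [small_sum_weighted]
    applies, by the halved block bound. *)
Lemma orbit_half_trace M d (I : {set 'I_n}) : symplectic M ->
  (forall i, 0 <= d 0 i) ->
  let A := M *m dblock d *m M^T in
  small_sum d #|I| <=
  \sum_(j in I) (A (lshift n j) (lshift n j) + A (rshift n j) (rshift n j)) / 2.
Proof.
move=> sM d0 /=.
pose q j k := (M (lshift n j) (lshift n k) ^+ 2 + M (lshift n j) (rshift n k) ^+ 2) +
     (M (rshift n j) (lshift n k) ^+ 2 + M (rshift n j) (rshift n k) ^+ 2).
have -> : \sum_(j in I) ((M *m dblock d *m M^T) (lshift n j) (lshift n j)
     + (M *m dblock d *m M^T) (rshift n j) (rshift n j)) / 2 =
    \sum_k d 0 k * (\sum_(j in I) q j k / 2).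
  under [RHS]eq_bigr do rewrite mulr_sumr.
  rewrite exchange_big; apply: eq_bigr => j _ /=.
  rewrite !orbit_diagE -big_split mulr_suml; apply: eq_bigr => k _ /=.
  by rewrite /q; ring.
have q0 j k : 0 <= q j k by rewrite /q !addr_ge0 ?sqr_ge0.
apply: small_sum_weighted => // [|k|K].
- by rewrite -[leqRHS]card_ord max_card.
- by apply: sumr_ge0 => j _; rewrite divr_ge0.
have := symplectic_block_weight _ I K sM.
rewrite exchange_big /=.
under [X in _ -> _ <= X]eq_bigr do rewrite -mulr_suml.
rewrite -mulr_suml -/(q _ _) !natrD.
set S := (X in _ <= X -> _); set S' := (X in _ -> _ <= X / 2).
have -> : S' = S by [].
by lra.
Qed.

(* A diagonal symplectic scaling makes the two diagonal entries of each pair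
   equal to their geometric mean, so that the arithmetic means in
   [orbit_half_trace] become the entries of [Delta_s]. *)
Lemma orbit_Sigma d x : (forall i, 0 < d 0 i) ->
  (exists2 A, in_sym_orbit d A & Delta_s A = x) -> Sigma d x.
Proof.
move=> d0 [A [M sM eA] eAx]; apply: small_sum_Sigma => I.
pose L (j : 'I_n) : 'I_(n + n) := lshift n j.
pose Q (j : 'I_n) : 'I_(n + n) := rshift n j.
have sq_ge0 a k : 0 <= M a (lshift n k) ^+ 2 + M a (rshift n k) ^+ 2.
  by rewrite addr_ge0 ?sqr_ge0.
(* A zero diagonal entry would make a row of [M] vanish, hence a row of the invertible
   [J = M J M^T]. *)
have Apos a : 0 < A a a.
  rewrite lt_def eA orbit_diagE sumr_ge0 ?andbT; last first.
    by move=> k _; rewrite mulr_ge0 // ltW.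
  apply/negP; rewrite psumr_eq0; last by move=> k _; rewrite mulr_ge0 // ltW.
  move/allP => M0.
  have {}M0 b : M a b = 0.
    case: (split_ordP b) => k ->.
      have := M0 k (mem_index_enum _); rewrite mulf_eq0 gt_eqF //=.
      by rewrite paddr_eq0 ?sqr_ge0 // !sqrf_eq0 => /andP[/eqP].
    have := M0 k (mem_index_enum _); rewrite mulf_eq0 gt_eqF //=.
    by rewrite paddr_eq0 ?sqr_ge0 // !sqrf_eq0 => /andP[_ /eqP].
  have rowJ : row a (Jmat R n) = 0.
    rewrite -(symplectic_tr _ _ _ sM) -mulmxA row_mul.
    suff -> : row a M = 0 by rewrite mul0mx.
    by apply/rowP => b; rewrite !mxE M0.
  have : row a (Jmat R n *m (Jmat R n)^T) = 0 by rewrite row_mul rowJ mul0mx.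
  rewrite mul_Jmat_tr => /rowP/(_ a); rewrite !mxE eqxx => /eqP.
  by rewrite oner_eq0.
have xE j : x 0 j = Num.sqrt (A (L j) (L j) * A (Q j) (Q j)) by rewrite -eAx mxE.
have xpos j : 0 < x 0 j by rewrite xE sqrtr_gt0 mulr_gt0.
have xsqr j : x 0 j ^+ 2 = A (L j) (L j) * A (Q j) (Q j).
  by rewrite xE sqr_sqrtr // ltW // mulr_gt0.
(* With [c_j^2 = x_j / a_jj], scaling by [c_j] and [c_j^-1] turns both diagonal entries of pair [j]
   into [x_j]. *)
pose c : 'rV[R]_n := \row_j Num.sqrt (x 0 j / A (L j) (L j)).
pose c' : 'rV[R]_n := \row_j (c 0 j)^-1.
have c2 j : c 0 j ^+ 2 = x 0 j / A (L j) (L j).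
  by rewrite mxE sqr_sqrtr // ltW // divr_gt0.
have c0 j : c 0 j != 0 by rewrite mxE gt_eqF // sqrtr_gt0 divr_gt0.
pose S : 'M[R]_(n + n) := diag_mx (row_mx c c').
have sS : symplectic S.
  rewrite /symplectic /S diag_mx_row tr_block_mx !tr_diag_mx !linear0 /Jmat.
  rewrite !mulmx_block !mul0mx !mulmx0 !mulmx1 !add0r !addr0 !mul0mx.
  rewrite mulmxN mulmx1 mulNmx !mulmx_diag.
  have cc : \row_j (c 0 j * c' 0 j) = const_mx 1.
    by apply/rowP => j; rewrite !mxE divff //; move: (c0 j); rewrite mxE.
  have cc' : \row_j (c' 0 j * c 0 j) = const_mx 1.
    by rewrite -cc; apply/rowP => j; rewrite !mxE mulrC.
  by rewrite cc cc' diag_const_mx.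
have sSM := symplectic_mul _ _ _ _ sS sM.
apply: le_trans (orbit_half_trace _ _ I sSM _) _; first by move=> i; apply: ltW.
apply: ler_sum => j _.
have SM a : (S *m M *m dblock d *m (S *m M)^T) a a = (row_mx c c' 0 a) ^+ 2 * A a a.
  rewrite eA !orbit_diagE mulr_sumr; apply: eq_bigr => k _.
  by rewrite /S !mul_diag_mxE; ring.
rewrite !SM row_mxEl row_mxEr [c' 0 j]mxE exprVn c2 -/(L j) -/(Q j).
have -> : A (Q j) (Q j) = x 0 j ^+ 2 / A (L j) (L j).
  by rewrite xsqr mulrC mulKf // gt_eqF.
rewrite le_eqVlt; apply/orP; left; apply/eqP; field.
by rewrite !gt_eqF.
Qed.

Lemma Sigma_orbit d x : (forall i, 0 < d 0 i) ->
  Sigma d x -> exists2 A, in_sym_orbit d A & Delta_s A = x.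
Proof.
move=> d0 [z [/majorized_rot_diag [O OO Oz] zx]].
have OtO := mulmx1C OO.
(* [z_i] weights the squares of a unit row of [O] by the positive [d_k]. *)
have z0 i : 0 < z 0 i.
  have zE : z 0 i = \sum_k d 0 k * O i k ^+ 2.
    rewrite -Oz mxE; apply: eq_bigr => k _.
    by rewrite mul_mx_diagE mxE; ring.
  have t0 k : 0 <= d 0 k * O i k ^+ 2 by rewrite mulr_ge0 ?sqr_ge0 // ltW.
  rewrite lt_def zE sumr_ge0 // andbT psumr_eq0 //; apply/negP => /allP O0.
  move/matrixP/(_ i i): OO; rewrite !mxE eqxx big1 => [/eqP|k _].
    by rewrite eq_sym oner_eq0.
  have := O0 k (mem_index_enum _); rewrite mulf_eq0 gt_eqF //= sqrf_eq0 => /eqP->.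
  by rewrite mul0r.
(* The radicand is nonnegative because [0 < z_i <= x_i]. *)
pose s : 'rV[R]_n := \row_i Num.sqrt ((x 0 i / z 0 i) ^+ 2 - 1).
have s2 i : 1 + s 0 i ^+ 2 = (x 0 i / z 0 i) ^+ 2.
  rewrite mxE sqr_sqrtr; first by rewrite addrC subrK.
  rewrite subr_ge0; apply: exprn_ege1.
  by rewrite ler_pdivlMr // mul1r.
pose S := diag_mx s.
(* The shear [block_mx 1 0 S 1], symplectic as [S] is symmetric, times [block_mx O 0 0 O],
   symplectic as [O] is orthogonal. *)
pose M := block_mx O 0 (S *m O) O.
exists (M *m dblock d *m M^T).
  exists M => //; rewrite /symplectic /M tr_block_mx trmx0 trmx_mul tr_diag_mx /Jmat.
  rewrite !mulmx_block !mul0mx !mulmx0 !mulmx1 !mulmxN !mulmx1 !add0r !addr0.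
  by rewrite !mulNmx OtO !mul0mx addr0 mulmxA addNr.
apply/rowP => j; rewrite mxE /M tr_block_mx trmx0 trmx_mul tr_diag_mx /dblock.
rewrite !mulmx_block !mul0mx !mulmx0 !add0r !addr0 block_mxEul block_mxEdr.
have -> : S *m O *m diag_mx d *m (O^T *m S) = S *m (O *m diag_mx d *m O^T) *m S.
  by rewrite !mulmxA.
rewrite [X in _ * X]mxE /S mul_mx_diagE mul_diag_mxE !Oz.
have -> : z 0 j * (s 0 j * z 0 j * s 0 j + z 0 j) =
    (z 0 j) ^+ 2 * (1 + s 0 j ^+ 2) by ring.
have xz : 0 <= x 0 j by rewrite (le_trans _ (zx j)) // ltW.
rewrite s2 -exprMn mulrC divfK ?gt_eqF // sqrtr_sqr ger0_norm //.
Qed.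

End Orbit.

Theorem theorem2 (R : realType) (n : nat) (d : 'rV[R]_n) :
  (forall i, 0 < d 0 i) ->
  forall x : 'rV[R]_n,
    (exists2 A : 'M[R]_(n + n), in_sym_orbit d A & Delta_s A = x) <-> Sigma d x.
Proof. by move=> d0 x; split; [apply: orbit_Sigma | apply: Sigma_orbit]. Qed.
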